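(* Let $p\in[1,\infty]$, $a,b\in\mathbb{R}$ with $b\neq 0$ and $|a|\neq |b|^{1/p}$ (with the convention $|b|^{1/p}=1$ when $p=\infty$). Define linear operators $T_b, M_{a,b}: L^p(\mathbb{R})\to L^p(\mathbb{R})$ by $(T_b f)(x)=f(bx)$ and $M_{a,b}f=(I-aT_b)f$, i.e. $(M_{a,b}f)(x)=f(x)-af(bx)$. Then $T_b$ and $M_{a,b}$ are homeomorphisms from $L^p(\mathbb{R})$ onto itself. Moreover: (1) $T_b^{-1}=T_{1/b}$; (2) $\|T_b\|_p=|b|^{-1/p}$; (3) for all $f\in L^p(\mathbb{R})$, $$\left|1-\frac{|a|}{|b|^{1/p}}\right|\,\|f\|_p\le \|M_{a,b}f\|_p\le \left(1+\frac{|a|}{|b|^{1/p}}\right)\|f\|_p;$$ (4) $$M_{a,b}^{-1}=\begin{cases}\sum_{n=0}^\infty a^nT_b^n & \text{if } |a|<|b|^{1/p},\\ -\sum_{n=1}^\infty \left(\frac1a\right)^n T_{1/b}^n & \text{if } |a|>|b|^{1/p}.\end{cases}$$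
   Context: $L^p(\mathbb{R})$ is the usual Lebesgue space of real-valued functions with norm $\|\cdot\|_p$ (essential supremum norm for $p=\infty$). For a bounded linear operator $H$ on $L^p(\mathbb{R})$, $\|H\|_p=\max\{\|Hf\|_p:\|f\|_p=1\}$. By convention $|b|^{1/p}=1$ when $p=\infty$. *)

(* Defs.v *)
From HB Require Import structures.
From mathcomp Require Import all_boot all_order all_algebra.
From mathcomp Require Import all_classical all_reals all_analysis.
Set Implicit Arguments. Unset Strict Implicit. Unset Printing Implicit Defensive.
Import Order.TTheory GRing.Theory Num.Theory.
Import numFieldNormedType.Exports.
Local Open Scope classical_set_scope.
Local Open Scope ring_scope.

Section Defs.
Context {R : realType}.

Definition Lp (p : \bar R) : {pred R -> R} := Lfun (@lebesgue_measure R) p.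

Definition Lpnorm (p : \bar R) (f : R -> R) : \bar R :=
  'N[@lebesgue_measure R]_p[EFin \o f]%E.

Definition Lpeq (f g : R -> R) : Prop := f = g %[ae (@lebesgue_measure R)].

Definition bpow (p : \bar R) (b : R) : R :=
  match p with
  | EFin r => `|b| `^ r^-1
  | _ => 1
  end.

Definition Tb (b : R) (f : R -> R) : R -> R := fun x => f (b * x).

Definition Mab (a b : R) (f : R -> R) : R -> R := fun x => f x - a * f (b * x).

Definition opnorm (p : \bar R) (H : (R -> R) -> (R -> R)) : \bar R :=
  ereal_sup [set Lpnorm p (H f) | f in [set f | f \in Lp p /\ Lpnorm p f = 1%E]].

(* H is a (well defined) homeomorphism from L^p(R) onto itself, where
   L^p(R) is the metric space of a.e.-classes of L^p functions. *)
Definition Lp_homeomorphism (p : \bar R) (H : (R -> R) -> (R -> R)) : Prop :=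
  [/\
      (forall f, f \in Lp p -> H f \in Lp p),
      (forall f g, f \in Lp p -> g \in Lp p -> Lpeq f g -> Lpeq (H f) (H g)),
      (forall f g, f \in Lp p -> g \in Lp p -> Lpeq (H f) (H g) -> Lpeq f g),
      (forall g, g \in Lp p -> exists f, f \in Lp p /\ Lpeq (H f) g) &
      ((forall f, f \in Lp p -> forall e : R, 0 < e -> exists d : R, 0 < d /\
         forall g, g \in Lp p -> (Lpnorm p (g \- f)%R < d%:E)%E ->
           (Lpnorm p (H g \- H f)%R < e%:E)%E) /\
      (forall f, f \in Lp p -> forall e : R, 0 < e -> exists d : R, 0 < d /\
         forall g, g \in Lp p -> (Lpnorm p (H g \- H f)%R < d%:E)%E ->
           (Lpnorm p (g \- f)%R < e%:E)%E))].

Definition neumann_lt (a b : R) (N : nat) (g : R -> R) : R -> R :=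
  fun x => \sum_(n < N) a ^+ n * iter n (Tb b) g x.

Definition neumann_gt (a b : R) (N : nat) (g : R -> R) : R -> R :=
  fun x => - \sum_(1 <= n < N.+1) (a^-1) ^+ n * iter n (Tb b^-1) g x.

Definition is_inverse_series (p : \bar R) (a b : R)
    (S : nat -> (R -> R) -> (R -> R)) : Prop :=
  exists Minv : (R -> R) -> (R -> R),
    [/\ (forall g, g \in Lp p -> Minv g \in Lp p),
        (forall g, g \in Lp p -> Lpeq (Mab a b (Minv g)) g),
        (forall f, f \in Lp p -> Lpeq (Minv (Mab a b f)) f),
        (forall N g, g \in Lp p -> S N g \in Lp p) &
        ((fun N => opnorm p (fun g => Minv g \- S N g)) @ \oo --> 0%E)].

End Defs.

(* Main.v *)
(** Since [lebesgue_measure] is scaled by [1 / |b|] under [x |-> b * x], the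
    dilation [Tb b] multiplies every L^p norm by exactly [(bpow p b)^-1]. With
    [t = |a| / bpow p b], the triangle inequality for [f - a * Tb b f] gives both
    [|1 - t| ||f|| <= ||Mab a b f||] and [||Mab a b f|| <= (1 + t) ||f||]. As
    [t <> 1], either [t < 1] or [t^-1 < 1], and the corresponding Neumann series
    is dominated in norm by a geometric series. Normally convergent series
    converge in L^p: the sum of the moduli has finite norm by Minkowski and
    monotone convergence, hence is finite almost everywhere. The limit inverts
    [Mab a b] because the partial sums do so up to a term of norm [O(q^N)]. *)

Require Import Defs.
From HB Require Import structures.
From mathcomp Require Import all_boot all_order all_algebra.
From mathcomp Require Import all_classical all_reals all_analysis.
From mathcomp Require Import measurable_realfun ess_sup_inf.
From mathcomp Require Import ring lra.
Set Implicit Arguments.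
Unset Strict Implicit.
Unset Printing Implicit Defensive.
Import Order.TTheory GRing.Theory Num.Theory.
Import numFieldNormedType.Exports.
Local Open Scope classical_set_scope.
Local Open Scope ring_scope.

(** * Dilations and Lebesgue measure *)

(** Intervals []x, y]] are the ones on which [lebesgue_measure_unique] tests a measure. A negative
    [b] reverses the order, so the closed end moves to the left. *)
Lemma preimage_mulr_itvoc (R : realType) (b x y : R) : b != 0 ->
  ( *%R b) @^-1` `]x, y] =
  if 0 < b then `]b^-1 * x, b^-1 * y]%classic else `[b^-1 * y, b^-1 * x[%classic.
Proof.
move=> b0; apply/seteqP; split => z /=; case: ltgtP b0 => // bb _ /=;
  rewrite !in_itv/=.
- by rewrite ltr_pdivrMl// ler_pdivlMl.
- by rewrite ler_ndivrMl// ltr_ndivlMl// andbC.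
- by rewrite ltr_pdivrMl// ler_pdivlMl.
- by rewrite ler_ndivrMl// ltr_ndivlMl// andbC.
Qed.

(** By uniqueness of Lebesgue measure: [|b|] times the pushforward along [*%R b] gives every
    interval []x, y]] its length. *)
Lemma lebesgue_measure_preimage_mulr (R : realType) (b : R) (A : set R) :
  b != 0 -> measurable A ->
  lebesgue_measure (( *%R b) @^-1` A) = ((`|b|^-1)%:E * lebesgue_measure A)%E.
Proof.
move=> b0 mA.
have nb0 : 0 < `|b| by rewrite normr_gt0.
have mb : measurable_fun [set: measurableTypeR R]
  ( *%R b : measurableTypeR R -> measurableTypeR R).
  exact: mulrl_measurable.
pose push : {measure set measurableTypeR R -> \bar R} :=
  pushforward lebesgue_measure
    ( *%R b : measurableTypeR R -> measurableTypeR R).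
pose nu := mscale (NngNum (ltW nb0)) (push mb).
have -> : lebesgue_measure A = nu A.
  apply: lebesgue_measure_unique => //= _ [[x y]] _ <-.
  rewrite /nu/= /mscale/= /pushforward/=.
  rewrite preimage_mulr_itvoc//= lebesgue_measure_itv/= lte_fin.
  move: b0; case: (ltgtP 0 b) => // bb _; rewrite lebesgue_measure_itv/= lte_fin.
    rewrite ltr_pM2l ?invr_gt0//; case: ifPn => _; last by rewrite mule0.
    rewrite -!EFinD -EFinM gtr0_norm//; congr EFin.
    by rewrite -mulrBr mulrA divff ?gt_eqF// mul1r.
  rewrite ltr_nM2l ?invr_lt0//; case: ifPn => _; last by rewrite mule0.
  rewrite -!EFinD -EFinM ltr0_norm//; congr EFin.
  by rewrite -mulrBr mulrA mulNr divff ?lt_eqF// mulN1r opprB.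
by rewrite /nu/= /mscale/= muleA -EFinM mulVf ?gt_eqF// mul1e.
Qed.

(** The left side is an integral against the pushforward of Lebesgue measure, which is Lebesgue
    measure scaled by [|b|^-1]. *)
Lemma ge0_integral_comp_mulr (R : realType) (b : R) (f : R -> \bar R) :
  b != 0 -> measurable_fun [set: R] f -> (forall x, 0 <= f x)%E ->
  (\int[lebesgue_measure]_x f (b * x)%R =
   (`|b|^-1)%:E * \int[lebesgue_measure]_x f x)%E.
Proof.
move=> b0 mf f0.
have mb : measurable_fun [set: measurableTypeR R]
  ( *%R b : measurableTypeR R -> measurableTypeR R).
  exact: mulrl_measurable.
have nb0 : 0 <= `|b|^-1 by rewrite invr_ge0.
transitivity (\int[pushforward lebesgue_measure
    ( *%R b : measurableTypeR R -> measurableTypeR R)]_x f x)%E.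
  by rewrite ge0_integral_pushforward//= preimage_setT.
rewrite -(ge0_integral_mscale lebesgue_measure measurableT (NngNum nb0) mf)//.
apply: eq_measure_integral => /= A mA _.
by rewrite /mscale/= /pushforward lebesgue_measure_preimage_mulr.
Qed.

(** * Normally convergent series in L^p *)

Lemma normed_series_bounded (R : realType) (u : R^nat) (B : R) :
  (forall N, \sum_(n < N) `|u n| <= B) ->
  cvgn (series u) /\ `|limn (series u)| <= B.
Proof.
move=> uB.
have cu : cvgn (series u).
  apply: (@normed_cvg _ R^o); apply: nondecreasing_is_cvgn.
    by apply/nondecreasing_series => n _ _; exact: normr_ge0.
  exists B => _ [N _ <-]; have := uB N.
    by rewrite -(big_mkord xpredT (fun i => `|u i|)).
split => //.
have cNu : `|series u n| @[n --> \oo] --> `|limn (series u)|.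
  by apply: (@cvg_norm _ R^o).
rewrite -(cvg_lim _ cNu)//; apply: limr_le; first exact: cvgP cNu.
apply: nearW => N; rewrite /series/= big_mkord.
exact: le_trans (ler_norm_sum _ _ _) (uB N).
Qed.

Section Lnorm_extra.
Context d (T : measurableType d) (R : realType).
Variables (mu : {measure set T -> \bar R}) (p : \bar R).
Hypothesis p1 : (1 <= p)%E.
Implicit Types (f g : T -> R) (h : nat -> T -> R).

Local Notation "''N' f" := ('N[mu]_p[EFin \o f])%E (at level 10, f at level 8).

Let measurable_normr_powR f (r : R) : measurable_fun [set: T] f ->
  measurable_fun [set: T] (fun x => (`|f x| `^ r)%:E).
Proof.
move=> mf; apply/measurable_EFinP.
apply: (@measurableT_comp _ _ _ _ _ _ (@powR R ^~ r)) => //.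
exact: measurableT_comp.
Qed.

Lemma le_Lnorm f g : measurable_fun [set: T] f -> measurable_fun [set: T] g ->
  (\forall x \ae mu, `|f x| <= `|g x|) -> ('N f <= 'N g)%E.
Proof.
move=> mf mg fg; rewrite unlock /Lnorm; case: p p1 => [r r1| _|//]; last first.
  case: ifPn => // _; apply: le_ess_sup.
  by apply: filterS fg => x /=; rewrite lee_fin.
have r0 : 0 < r by rewrite (lt_le_trans ltr01).
rewrite gt0_ler_poweR ?invr_ge0 ?(ltW r0)//.
- by rewrite in_itv/= leey andbT; apply: integral_ge0 => x _.
- by rewrite in_itv/= leey andbT; apply: integral_ge0 => x _.
apply: ae_ge0_le_integral => //.
- by move=> x _; exact: poweR_ge0.
- exact: measurable_normr_powR.
- by move=> x _; exact: poweR_ge0.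
- exact: measurable_normr_powR.
apply: filterS fg => x fgx _ /=.
by rewrite lee_fin ge0_ler_powR ?nnegrE// ltW.
Qed.

(** Lets norm estimates prove equality of a.e. classes. *)
Lemma Lnorm_sub_eq0P f g :
  measurable_fun [set: T] f -> measurable_fun [set: T] g ->
  ('N (f \- g)%R = 0)%E <-> f = g %[ae mu].
Proof.
move=> mf mg; have mfg : measurable_fun [set: T] (f \- g).
  exact: measurable_funB.
split=> [|fg].
  move/Lnorm_eq0_eq0 => fg0; have {fg0} := fg0 _ _.
  move=> /(_ (iffRL (measurable_EFinP _ _) mfg) (lt_le_trans lte01 p1)).
  apply: filterS => x /= /(_ Logic.I) [] /eqP.
  by rewrite subr_eq0 => /eqP.
apply/eqP; rewrite eq_le Lnorm_ge0 andbT.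
have <- : 'N (cst 0%R : T -> R) = 0%E.
  by apply: Lnorm0; rewrite gt_eqF// (lt_le_trans _ p1).
apply: le_Lnorm => //; apply: filterS fg => x /= -> //.
by rewrite subrr.
Qed.

(** The sums of moduli [s N] increase. For [p = +oo] they are at most [C] off one null set; for
    finite [r], monotone convergence bounds the integral of the limit of [s N x]^ r[by]C [^ r], so
    this limit is finite a.e. Either way the series converges absolutely a.e., and its sum inherits
    the bound. *)
Lemma Lnorm_normal_series h (C : R) :
  (forall n, measurable_fun [set: T] (h n)) ->
  (forall N, 'N (fun x => (\sum_(n < N) `|h n x|)%R) <= C%:E)%E ->
  (\forall x \ae mu, cvgn (series (h ^~ x))) /\
  (forall f, measurable_fun [set: T] f ->
    (\forall x \ae mu, series (h ^~ x) @ \oo --> f x) -> ('N f <= C%:E)%E).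
Proof.
move=> mh hC.
have C0 : 0 <= C by rewrite -lee_fin (le_trans _ (hC 0%N))// Lnorm_ge0.
pose s N x := \sum_(n < N) `|h n x|.
have ms N : measurable_fun [set: T] (s N).
  by apply: measurable_sum => n; exact: measurableT_comp.
have s0 N x : 0 <= s N x by apply: sumr_ge0.
have sB x := @normed_series_bounded R (h ^~ x).
move: hC; rewrite unlock /Lnorm; case: p p1 => [r r1| _|//] hC; last first.
  (* At [p = +oo] the norm is 0 by convention when the whole space is null; then every property
     holds a.e. *)
  have [mu0|mu0] := ltP 0%E (mu [set: T]); last first.
    have muT0 : mu [set: T] = 0%E by apply/eqP; rewrite eq_le measure_ge0 andbT.
    by split => [|f _ _]; [exact: measure0_ae|rewrite lee_fin].
  rewrite mu0 in hC.
  have sC : \forall x \ae mu, forall N, s N x <= C.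
    apply: ae_foralln => N; have /ess_supP := hC N.
    by apply: filterS => x /=; rewrite lee_fin ger0_norm// -/(s N x).
  split; first by apply: filterS sC => x /sB[].
  move=> f mf fE; apply/ess_supP; apply: filterS2 sC fE => x.
  by move=> /sB[_ +] /cvg_lim fx; rewrite /= lee_fin fx.
have r0 : 0 < r by rewrite (lt_le_trans ltr01).
have rV0 : 0 < r^-1 by rewrite invr_gt0.
pose g N x := (s N x `^ r)%:E.
have mg N : measurable_fun [set: T] (g N).
  rewrite (_ : g N = fun x => (`|s N x| `^ r)%:E); last first.
    by apply/funext => x; rewrite ger0_norm.
  exact: measurable_normr_powR.
have g0 N x : (0 <= g N x)%E by rewrite lee_fin powR_ge0.
have ndg x : nondecreasing_seq (g ^~ x).
  move=> m n mn; rewrite lee_fin ge0_ler_powR ?nnegrE//; first exact: ltW.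
  rewrite /s -(big_mkord xpredT (fun i => `|h i x|)).
  rewrite -[leRHS](big_mkord xpredT (fun i => `|h i x|)).
  by apply: (@nondecreasing_series _ (fun i => `|h i x|) xpredT).
(* The limit is taken in [\bar R], so it exists at every point, possibly as [+oo]. *)
pose F x := limn (g ^~ x).
have gF N x : (g N x <= F x)%E.
  rewrite /F (cvg_lim _ (ereal_nondecreasing_cvgn (ndg x)))//.
  by apply: ereal_sup_ubound; exists N.
have F0 x : (0 <= F x)%E by rewrite (le_trans (g0 0%N x)).
have mF : measurable_fun [set: T] F.
  apply: (emeasurable_fun_cvg g) => // x _.
  exact: ereal_nondecreasing_is_cvgn.
have intg N : (\int[mu]_x g N x <= (C `^ r)%:E)%E.
  have := hC N.
  have -> : (\int[mu]_x
     (`|(EFin \o (fun y => (\sum_(n < N) `|h n y|)%R)) x| `^ r) =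
      \int[mu]_x g N x)%E.
    apply: eq_integral => x _.
    by rewrite /g /= ger0_norm// -/(s N x).
  move=> /(gt0_ler_poweR (ltW r0)); rewrite -poweRrM mulVf ?gt_eqF//.
  rewrite poweRe1; last exact: integral_ge0.
  by apply; rewrite in_itv/= leey andbT ?poweR_ge0.
have intF : (\int[mu]_x F x <= (C `^ r)%:E)%E.
  have cF := cvg_monotone_convergence (mu := mu) measurableT mg
    (fun n x _ => g0 n x) (fun x _ => ndg x).
  rewrite -(cvg_lim _ cF)//; apply: lime_le; first exact: cvgP cF.
  exact: nearW.
have aeF : \forall x \ae mu, F x \is a fin_num.
  have /integrable_ae : mu.-integrable [set: T] F.
    apply/integrableP; split => //.
    under eq_integral do rewrite gee0_abs//.
    by rewrite (le_lt_trans intF)// ltry.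
  by move=> /(_ measurableT); apply: filterS => x; exact.
(* Where [F x] is finite, its [r]-th root is a bound uniform in [N], as [normed_series_bounded]
   requires. *)
have sF : \forall x \ae mu, forall N, s N x <= fine (F x) `^ r^-1.
  apply: filterS aeF => x Fx N.
  rewrite -[leLHS]powRr1// -(divff (lt0r_neq0 r0)) powRrM.
  rewrite ge0_ler_powR ?nnegrE ?powR_ge0 ?fine_ge0//; first exact: ltW.
  by rewrite -lee_fin fineK// gF.
split; first by apply: filterS sF => x /sB[].
move=> f mf fE.
have -> : C%:E = ((C `^ r)%:E `^ r^-1)%E.
  by rewrite poweR_EFin -powRrM divff ?gt_eqF// powRr1.
rewrite gt0_ler_poweR ?(ltW rV0)//.
- by rewrite in_itv/= leey andbT; apply: integral_ge0 => x _.
- by rewrite in_itv/= leey andbT lee_fin powR_ge0.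
apply: le_trans intF; apply: ae_ge0_le_integral => //.
- by move=> x _; exact: poweR_ge0.
- exact: measurable_normr_powR.
apply: filterS3 aeF sF fE => x Fx /sB[_ +] /cvg_lim fx _.
rewrite fx// => {}fx.
rewrite -(fineK Fx) lee_fin /=.
rewrite (le_trans (ge0_ler_powR _ _ _ fx)) ?nnegrE ?powR_ge0//.
  exact: ltW.
by rewrite -powRrM mulVf ?gt_eqF// powRr1// fine_ge0.
Qed.
End Lnorm_extra.

Section Lfun_series.
Context d (T : measurableType d) (R : realType).
Variables (mu : {measure set T -> \bar R}) (p : \bar R).
Hypothesis p1 : (1 <= p)%E.
Implicit Types (f g : T -> R) (h : nat -> T -> R).

Local Notation "''N' f" := ('N[mu]_p[EFin \o f])%E (at level 10, f at level 8).

Lemma Lfun_mem f :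
  f \in Lfun mu p <-> measurable_fun [set: T] f /\ ('N f < +oo)%E.
Proof.
split=> [/andP[]|[mf Nf]]; first by rewrite !inE.
by apply/andP; split; rewrite inE.
Qed.

Lemma Lnorm_scale f (c : R) : f \in Lfun mu p ->
  'N (fun x => (c * f x)%R) = (`|c|%:E * 'N f)%E.
Proof. by move=> fp; rewrite -(LnormZ (Lfun_Sub p1 fp) c). Qed.

Lemma Lnorm_sum_le h (rho : nat -> R) N :
  (forall n, measurable_fun [set: T] (h n)) ->
  (forall n, 'N (h n) <= (rho n)%:E)%E ->
  ('N (fun x => (\sum_(n < N) `|h n x|)%R) <= (\sum_(n < N) rho n)%:E)%E.
Proof.
move=> mh hr; elim: N => [|N IH].
  under eq_Lnorm do rewrite /= big_ord0.
  by rewrite big_ord0 (Lnorm0 mu)// gt_eqF// (lt_le_trans _ p1).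
have eqs : (fun x => \sum_(n < N.+1) `|h n x|) =
    (fun x => \sum_(n < N) `|h n x|) \+ (fun x => `|h N x|).
  by apply/funext => x /=; rewrite big_ord_recr.
rewrite eqs big_ord_recr EFinD; apply: le_trans (eminkowski _ _ _ _) _ => //.
- by apply: measurable_sum => n; exact: measurableT_comp.
- exact: measurableT_comp.
- apply: leeD => //; apply: le_trans (hr N).
  by rewrite -[in leRHS]Lnorm_abse.
Qed.

(** Completeness of L^p in quantitative form. [Lnorm_normal_series] is applied to the whole series
    to obtain the sum, then to each tail to bound the remainder by the remainder of the majorant
    [rho]. *)
Lemma Lfun_series_cvg h (rho : nat -> R) (S : R) :
  (forall n, h n \in Lfun mu p) -> (forall n, 'N (h n) <= (rho n)%:E)%E ->
  series rho @ \oo --> S ->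
  exists2 f, f \in Lfun mu p & forall N,
    ('N (fun x => (f x - \sum_(n < N) h n x)%R)
     <= (S - \sum_(n < N) rho n)%:E)%E.
Proof.
move=> hp hr rS.
have mh n : measurable_fun [set: T] (h n) by have /Lfun_mem[] := hp n.
have r0 n : 0 <= rho n by rewrite -lee_fin (le_trans _ (hr n))// Lnorm_ge0.
have sum_le N : \sum_(n < N) rho n <= S.
  rewrite -(cvg_lim _ rS)// -(big_mkord xpredT rho).
  apply: (nondecreasing_cvgn_le _ (cvgP _ rS)).
  by apply: nondecreasing_series.
have tail_le N M : \sum_(n < M) rho (N + n)%N <= S - \sum_(n < N) rho n.
  by rewrite lerBrDl (le_trans _ (sum_le (N + M)%N))// big_split_ord.
have tailN N M : ('N (fun x => (\sum_(n < M) `|h (N + n)%N x|)%R)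
    <= (S - \sum_(n < N) rho n)%:E)%E.
  apply: le_trans (@Lnorm_sum_le (fun n => h (N + n)%N)
    (fun n => rho (N + n)%N) _ _ _) _ => //.
  by rewrite lee_fin.
(* The limsup is measurable even where the series diverges. *)
pose f x := fine (limn_esup (fun N => (\sum_(n < N) h n x)%:E)).
have mf : measurable_fun [set: T] f.
  apply: (@measurableT_comp _ _ _ _ _ _ fine); first exact: fine_measurable.
  apply: measurable_fun_limn_esup => N; apply/measurable_EFinP.
  exact: measurable_sum.
have hf : \forall x \ae mu, series (h ^~ x) @ \oo --> f x.
  have [+ _] := @Lnorm_normal_series _ _ _ mu p p1 h _ mh (tailN 0%N).
  apply: filterS => x cx; suff -> : f x = limn (series (h ^~ x)) by [].
  rewrite /f (_ : (fun _ => _) = EFin \o series (h ^~ x)); last first.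
    by apply/funext => N /=; rewrite /series/= big_mkord.
  rewrite is_cvg_limn_esupE ?EFin_lim//.
  by apply: cvg_comp cx _.
have fN N : ('N (fun x => (f x - \sum_(n < N) h n x)%R)
     <= (S - \sum_(n < N) rho n)%:E)%E.
  have [_] := @Lnorm_normal_series _ _ _ mu p p1 _ _
    (fun n => mh (N + n)%N) (tailN N).
  apply; first by apply: measurable_funB => //; exact: measurable_sum.
  apply: filterS hf => x hx.
  have -> : series (fun n => h (N + n)%N x) =
      (fun M => series (h ^~ x) (M + N)%N - \sum_(n < N) h n x).
    apply/funext => M; rewrite /series/= !big_mkord (addnC M) big_split_ord/=.
    by rewrite [RHS]addrC addKr.
  by apply: cvgB; [rewrite cvg_shiftn | exact: cvg_cst].
exists f => //; apply/Lfun_mem; split => //.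
(* The remainder at [N = 0] is [f] itself, so its norm is finite. *)
have := fN 0%N; rewrite big_ord0 subr0.
under eq_Lnorm do rewrite /= big_ord0 subr0.
by move=> /le_lt_trans; apply; rewrite ltry.
Qed.
End Lfun_series.

(** * The operators [Tb] and [Mab] *)

Section dilation.
Context (R : realType).
Implicit Types (p : \bar R) (a b c : R) (f g : R -> R).

Lemma bpow_gt0 p b : b != 0 -> 0 < bpow p b.
Proof. by move=> b0; case: p => //= r; rewrite powR_gt0// normr_gt0. Qed.

Lemma bpowV p b : bpow p b^-1 = (bpow p b)^-1.
Proof.
case: p => [r| |]; rewrite /= ?invr1// normfV.
rewrite -(powR_inv1 (normr_ge0 b)) -powRrM mulrC powRrM.
by rewrite powR_inv1 ?powR_ge0.
Qed.

Lemma ae_comp_mulr b (P : R -> Prop) : b != 0 ->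
  (\forall x \ae (@lebesgue_measure R), P x) ->
  \forall x \ae (@lebesgue_measure R), P (b * x).
Proof.
move=> b0 [A [mA A0 PA]]; exists (( *%R b) @^-1` A); split.
- rewrite -[X in measurable X]setTI.
  exact: (mulrl_measurable b measurableT).
- by rewrite /= lebesgue_measure_preimage_mulr// A0 mule0.
- by move=> x /= Px; exact: PA.
Qed.

Lemma measurable_Tb b f : measurable_fun [set: measurableTypeR R] f ->
  measurable_fun [set: measurableTypeR R] (Tb b f).
Proof.
move=> mf; apply: (measurableT_comp mf).
exact: mulrl_measurable.
Qed.

(** For finite [p] this is the change of variables followed by an [r]-th root. For [p = +oo] it
    rests on dilations preserving null sets. *)
Lemma Lpnorm_Tb p b f : (1 <= p)%E -> b != 0 ->
  measurable_fun [set: measurableTypeR R] f ->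
  Lpnorm p (Tb b f) = (((bpow p b)^-1)%:E * Lpnorm p f)%E.
Proof.
move=> p1 b0 mf; rewrite /Lpnorm unlock /Lnorm; case: p p1 => [r r1|_|//].
  have r0 : 0 < r by rewrite (lt_le_trans ltr01).
  rewrite [X in (X `^ _)%E](_ : _ =
      ((`|b|^-1)%:E * \int[lebesgue_measure]_x (`|(EFin \o f) x| `^ r))%E).
    rewrite poweRM ?integral_ge0 ?lee_fin ?invr_ge0//; last first.
      by move=> x _; exact: poweR_ge0.
    by rewrite poweR_EFin; congr (_%:E * _)%E; rewrite -normfV -bpowV.
  rewrite -(@ge0_integral_comp_mulr R b (fun x => `|(EFin \o f) x| `^ r)%E)//.
  - apply/measurable_EFinP.
    apply: (@measurableT_comp _ _ _ _ _ _ (@powR R ^~ r)) => //.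
    exact: measurableT_comp.
  - by move=> x; exact: poweR_ge0.
rewrite /= invr1 mul1e; case: ifPn => // _.
(* Stated for every nonzero factor: the reverse inequality is the case of [b^-1] applied to
   [Tb b f]. *)
have le_dil c g : c != 0 -> (ess_sup lebesgue_measure (abse \o (EFin \o Tb c g))
    <= ess_sup lebesgue_measure (abse \o (EFin \o g)))%E.
  move=> c0; apply/ess_supP.
  pose M := ess_sup lebesgue_measure (abse \o (EFin \o g)).
  apply: (@ae_comp_mulr c (fun x => (`|g x|%:E <= M)%E) c0).
  exact: ess_sup_ge.
apply/eqP; rewrite eq_le le_dil//=.
have {1}-> : f = Tb b^-1 (Tb b f).
  by apply/funext => x; rewrite /Tb mulrA divff// mul1r.
by rewrite le_dil// invr_eq0.
Qed.

(** Ensures that the supremum in [opnorm] runs over a nonempty set; over the empty set it would be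
    [-oo]. *)
Lemma exists_Lpnorm1 p : (1 <= p)%E ->
  exists f : R -> R, f \in Lp p /\ Lpnorm p f = 1%E.
Proof.
move=> p1.
suff [f mf Nf] : exists2 f : R -> R,
    measurable_fun [set: measurableTypeR R] f & Lpnorm p f = 1%E.
  exists f; split => //; apply/Lfun_mem; split => //.
  by rewrite -/(Lpnorm p f) Nf ltry.
rewrite /Lpnorm unlock /Lnorm; case: p p1 => [r r1|_|//].
  have r0 : 0 < r by rewrite (lt_le_trans ltr01).
  exists (\1_`[0, 1]); first exact: measurable_indic.
  rewrite [X in (X `^ _)%E](_ : _ =
      \int[lebesgue_measure]_x (\1_(`[0%R, 1%R] : set R) x)%:E)%E.
    rewrite integral_indic// setIT/= lebesgue_measure_itv/= lte_fin ltr01.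
    by rewrite oppr0 adde0 poweR1r.
  apply: eq_integral => x _ /=; rewrite indicE.
  by case: (_ \in _); rewrite ?normr1 ?powR1// normr0 powR0// gt_eqF.
exists (cst 1) => //.
have muT0 : (0 < @lebesgue_measure R [set: R])%E.
  rewrite (@lt_le_trans _ _ (lebesgue_measure (`[0, 1]%classic : set R)))//.
    by rewrite lebesgue_measure_itv/= lte_fin ltr01 oppr0 adde0 lte01.
  by apply: le_measure; rewrite ?inE.
rewrite muT0; apply: ess_sup_ae_cst => //; apply: nearW => x /=.
by rewrite normr1.
Qed.

End dilation.

(** * Norm bounds, homeomorphisms and inversion by series in L^p *)

Section Lp.
Context (R : realType) (p : \bar R).
Hypothesis p1 : (1 <= p)%E.
Implicit Types (a b c : R) (f g : R -> R).

Lemma Lp_measurable f :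
  f \in Lp p -> measurable_fun [set: measurableTypeR R] f.
Proof. by move=> /Lfun_mem[]. Qed.

Lemma Lpnorm_fin f : f \in Lp p -> exists2 r : R, 0 <= r & Lpnorm p f = r%:E.
Proof.
move=> /Lfun_mem[_ Nf]; have f0 : (0 <= Lpnorm p f)%E by exact: Lnorm_ge0.
exists (fine (Lpnorm p f)); first exact: fine_ge0.
by rewrite fineK// ge0_fin_numE.
Qed.

Lemma LpD f g : f \in Lp p -> g \in Lp p -> f \+ g \in Lp p.
Proof. by move=> fp gp; apply: (Lfun_addr_closed lebesgue_measure p1).2. Qed.

Lemma LpZ c f : f \in Lp p -> (fun x => c * f x) \in Lp p.
Proof.
move=> fp; have [l0 lZ] := Lfun_submod_closed lebesgue_measure p1.
have := lZ c f 0 fp l0; rewrite addr0.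
by [].
Qed.

Lemma LpB f g : f \in Lp p -> g \in Lp p -> f \- g \in Lp p.
Proof.
move=> fp gp; rewrite (_ : f \- g = f \+ (- g))//; apply: LpD => //.
exact: (@Lfun_oppr_closed _ _ _ lebesgue_measure p).
Qed.

Lemma Lp_sum (F : nat -> R -> R) N : (forall n, F n \in Lp p) ->
  (fun x => \sum_(n < N) F n x) \in Lp p.
Proof.
move=> Fp; elim: N => [|N IH].
  rewrite (_ : (fun _ => _) = cst 0); last first.
    by apply/funext => x; rewrite big_ord0.
  exact: (Lfun_addr_closed lebesgue_measure p1).1.
rewrite (_ : (fun _ => _) = (fun x => \sum_(n < N) F n x) \+ F N).
  exact: LpD.
by apply/funext => x; rewrite big_ord_recr.
Qed.

Lemma Lp_Tb b f : b != 0 -> f \in Lp p -> Tb b f \in Lp p.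
Proof.
move=> b0 fp; have mf := Lp_measurable fp.
apply/Lfun_mem; split; first exact: measurable_Tb.
rewrite -/(Lpnorm p (Tb b f)) Lpnorm_Tb//.
by have [r _ ->] := Lpnorm_fin fp; rewrite ltry.
Qed.

Lemma Lp_Mab a b f : b != 0 -> f \in Lp p -> Mab a b f \in Lp p.
Proof. by move=> b0 fp; apply: LpB => //; apply: LpZ; exact: Lp_Tb. Qed.

Lemma Lpnorm_iter_Tb b f n : b != 0 -> f \in Lp p ->
  iter n (Tb b) f \in Lp p /\
  Lpnorm p (iter n (Tb b) f) = (((bpow p b)^-1 ^+ n)%:E * Lpnorm p f)%E.
Proof.
move=> b0 fp; elim: n => [|n [IHp IHn]] /=; first by rewrite mul1e.
split; first exact: Lp_Tb.
by rewrite Lpnorm_Tb ?IHn// ?muleA -?EFinM -?exprS//; exact: Lp_measurable.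
Qed.

Lemma Lpnorm_Mab_le a b f : b != 0 -> f \in Lp p ->
  (Lpnorm p (Mab a b f) <= (1 + `|a| / bpow p b)%:E * Lpnorm p f)%E.
Proof.
move=> b0 fp; have Tfp := Lp_Tb b0 fp.
rewrite (_ : Mab a b f = f \+ (fun x => - a * Tb b f x)); last first.
  by apply/funext => x; rewrite /Mab/= mulNr.
apply: le_trans (eminkowski _ _ _ _) _ => //.
- exact: Lp_measurable.
- by apply: Lp_measurable; exact: LpZ.
rewrite Lnorm_scale// normrN -!/(Lpnorm _ _) Lpnorm_Tb//; last first.
  exact: Lp_measurable.
have [r r0 ->] := Lpnorm_fin fp.
by rewrite -!EFinM -EFinD lee_fin mulrDl mul1r mulrA.
Qed.

(** Two triangle inequalities, one per sign of [1 - t] with [t = |a| / bpow p b]: [f] is the sum of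
    [Mab a b f] and [a * Tb b f], and [a * Tb b f] is the difference of [f] and [Mab a b f]. *)
Lemma Lpnorm_Mab_ge a b f : b != 0 -> f \in Lp p ->
  ((`|1 - `|a| / bpow p b|)%:E * Lpnorm p f <= Lpnorm p (Mab a b f))%E.
Proof.
move=> b0 fp; have Tfp := Lp_Tb b0 fp; have Mfp := Lp_Mab a b0 fp.
have aTfp := LpZ a Tfp.
have aTN : Lpnorm p (fun x => a * Tb b f x) =
    ((`|a| / bpow p b)%:E * Lpnorm p f)%E.
  rewrite /Lpnorm Lnorm_scale// -!/(Lpnorm _ _) Lpnorm_Tb ?EFinM ?muleA//.
  exact: Lp_measurable.
have fM : (Lpnorm p f <=
    Lpnorm p (Mab a b f) + Lpnorm p (fun x => a * Tb b f x)%R)%E.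
  rewrite {1}(_ : f = Mab a b f \+ (fun x => a * Tb b f x)); last first.
    by apply/funext => x; rewrite /Mab/Tb/= subrK.
  by apply: eminkowski => //; exact: Lp_measurable.
have aM : (Lpnorm p (fun x => a * Tb b f x)%R <=
    Lpnorm p f + Lpnorm p (Mab a b f))%E.
  (* Minkowski is stated for sums, so the difference is written with a factor [-1] and the norm
     absorbs the sign. *)
  rewrite [in leRHS](_ : Mab a b f = fun x => - ((-1) * Mab a b f x)); last first.
    by apply/funext => x; rewrite mulN1r opprK.
  rewrite {1}(_ : (fun x => a * Tb b f x) = f \+ (fun x => (-1) * Mab a b f x)).
    rewrite -[X in (_ <= _ + X)%E](oppe_Lnorm lebesgue_measure).
    under [X in (_ <= _ + X)%E]eq_Lnorm do rewrite /= opprK.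
    by apply: eminkowski => //; apply: Lp_measurable => //; exact: LpZ.
  by apply/funext => x; rewrite /Mab/Tb/=; ring.
move: fM aM; rewrite aTN.
have [r r0 ->] := Lpnorm_fin fp; have [m m0 ->] := Lpnorm_fin Mfp.
rewrite -!EFinM -!EFinD !lee_fin.
set t := `|a| / bpow p b => h1 h2.
by case: (ger0P (1 - t)) => _; lra.
Qed.

Lemma LpeqP f g : f \in Lp p -> g \in Lp p ->
  Lpnorm p (f \- g) = 0%E <-> Lpeq f g.
Proof. by move=> fp gp; apply: Lnorm_sub_eq0P => //; exact: Lp_measurable. Qed.

(** The upper bound gives compatibility with a.e. equality and continuity; the lower bound gives
    injectivity and continuity of the inverse. *)
Lemma bounded_below_homeomorphism (H : (R -> R) -> (R -> R)) (c C : R) :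
  0 < c -> 0 < C ->
  (forall f, f \in Lp p -> H f \in Lp p) ->
  (forall f g, H f \- H g = H (f \- g)) ->
  (forall f, f \in Lp p -> (c%:E * Lpnorm p f <= Lpnorm p (H f))%E) ->
  (forall f, f \in Lp p -> (Lpnorm p (H f) <= C%:E * Lpnorm p f)%E) ->
  (forall g, g \in Lp p -> exists f, f \in Lp p /\ Lpeq (H f) g) ->
  Lp_homeomorphism p H.
Proof.
move=> c0 C0 Hp HB Hge Hle Hsurj; split => //.
- move=> f g fp gp /LpeqP-/(_ fp gp) fg; apply/LpeqP; [exact: Hp..|].
  apply/eqP; rewrite eq_le Lnorm_ge0 andbT HB.
  by rewrite (le_trans (Hle _ (LpB fp gp)))// fg mule0.
- move=> f g fp gp /LpeqP-/(_ (Hp _ fp) (Hp _ gp)) fg; apply/LpeqP => //.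
  have := Hge _ (LpB fp gp); rewrite -HB fg.
  have [r r0 ->] := Lpnorm_fin (LpB fp gp).
  rewrite -EFinM lee_fin pmulr_rle0// => rle0.
  by congr EFin; apply/eqP; rewrite eq_le rle0.
- split => f fp e e0.
  + exists (e / C); split; first exact: divr_gt0.
    move=> g gp gf; rewrite HB (le_lt_trans (Hle _ (LpB gp fp)))//.
    have [r r0 rE] := Lpnorm_fin (LpB gp fp).
    by move: gf; rewrite rE -EFinM !lte_fin ltr_pdivlMr// mulrC.
  + exists (c * e); split; first exact: mulr_gt0.
    move=> g gp; rewrite HB; move: (Hge _ (LpB gp fp)).
    have [r r0 ->] := Lpnorm_fin (LpB gp fp).
    move=> /le_lt_trans /[apply].
    by rewrite -EFinM !lte_fin ltr_pM2l.
Qed.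

(** Common core of both series: the terms are dominated by [q ^+ n], and the partial sums invert
    [Mab a b] on the right up to [q ^+ N]. *)
Lemma neumann_is_inverse a b (S h : nat -> (R -> R) -> (R -> R)) (q : R) :
  b != 0 -> `|a| != bpow p b -> 0 <= q < 1 ->
  (forall N g, S N g = fun x => \sum_(n < N) h n g x) ->
  (forall n g, g \in Lp p -> h n g \in Lp p) ->
  (forall n g, g \in Lp p ->
    (Lpnorm p (h n g) <= (q ^+ n)%:E * Lpnorm p g)%E) ->
  (forall N g, g \in Lp p ->
    (Lpnorm p (Mab a b (S N g) \- g)%R <= (q ^+ N)%:E * Lpnorm p g)%E) ->
  is_inverse_series p a b S.
Proof.
move=> b0 aB /andP[q0 q1] SE hp hN res.
have nq1 : `|q| < 1 by rewrite ger0_norm.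
have q10 : 0 < 1 - q by rewrite subr_gt0.
have Sp N g : g \in Lp p -> S N g \in Lp p.
  by move=> gp; rewrite SE; apply: (@Lp_sum (h ^~ g)) => n; exact: hp.
(* [Minv] must be total, so the membership of [g] is a premise under the existential; outside L^p
   any value will do. The constant is the geometric tail [q ^+ N / (1 - q)]. *)
have /choice[Minv MinvP] : forall g, exists f, g \in Lp p ->
    f \in Lp p /\ forall N, (Lpnorm p (f \- S N g)%R
      <= (q ^+ N / (1 - q))%:E * Lpnorm p g)%E.
  move=> g; case: (boolP (g \in Lp p)) => gp; last by exists g.
  have [x x0 gx] := Lpnorm_fin gp.
  have [|f fp fS] := @Lfun_series_cvg _ _ _ lebesgue_measure p p1 (h ^~ g)
    (geometric x q) (x / (1 - q)) (fun n => hp n g gp) _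
    (@cvg_geometric_series _ x _ nq1).
    by move=> n; apply: le_trans (hN n g gp) _; rewrite gx -EFinM mulrC.
  exists f => _; split => // N; rewrite SE; apply: le_trans (fS N) _.
  rewrite gx -EFinM lee_fin.
  have -> : \sum_(n < N) geometric x q n = series (geometric x q) N.
    by rewrite /series/= big_mkord.
  rewrite geometric_seriesE ?lt_eqF//=.
  by rewrite le_eqVlt; apply/orP; left; apply/eqP; ring.
have MMinv g : g \in Lp p -> Lpeq (Mab a b (Minv g)) g.
  move=> gp; have [fp fS] := MinvP g gp.
  apply/LpeqP => //; first exact: Lp_Mab.
  have [y y0 yE] := Lpnorm_fin (LpB (Lp_Mab a b0 fp) gp).
  have [x x0 gx] := Lpnorm_fin gp.
  rewrite yE; congr EFin; apply/eqP; rewrite eq_le y0 andbT.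
  (* The residual splits into [Mab] of the truncation error, at most
     [(1 + t) * q ^+ N / (1 - q) * x], and the residual of the partial sum, at most [q ^+ N * x].
     Hence it is below [D * q ^+ N] for all [N]. *)
  pose D := ((1 + `|a| / bpow p b) / (1 - q) + 1) * x.
  have cD := @cvg_geometric _ D _ nq1.
  rewrite -(cvg_lim _ cD)//; apply: limr_ge; first exact: cvgP cD.
  apply: nearW => N /=; rewrite -lee_fin -yE.
  rewrite (_ : Mab a b (Minv g) \- g =
      Mab a b (Minv g \- S N g) \+ (Mab a b (S N g) \- g)); last first.
    by apply/funext => z; rewrite /Mab/=; ring.
  have dp := LpB fp (Sp N g gp).
  apply: le_trans (eminkowski _ _ _ _) _ => //.
  - by apply: Lp_measurable; exact: Lp_Mab.
  - by apply: Lp_measurable; apply: LpB => //; apply: Lp_Mab => //; exact: Sp.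
  apply: le_trans (leeD (@Lpnorm_Mab_le a b _ b0 dp) (res N g gp)) _.
  move: (fS N); have [z z0 ->] := Lpnorm_fin dp.
  rewrite gx -!EFinM -EFinD !lee_fin => zle.
  have B0 := bpow_gt0 p b0.
  have k0 : 0 <= 1 + `|a| / bpow p b by rewrite addr_ge0// divr_ge0// ltW.
  apply: le_trans (lerD (ler_wpM2l k0 zle) (lexx _)) _.
  by rewrite le_eqVlt; apply/orP; left; apply/eqP; rewrite /D; ring.
exists Minv; split => //.
- by move=> g gp; have [] := MinvP g gp.
(* Left inverse: [Minv (Mab a b f)] and [f] have a.e. equal images by the right inverse property,
   and [Mab a b] is bounded below since [t] differs from 1. *)
- move=> f fp; have Mfp := Lp_Mab a b0 fp; have [gp _] := MinvP _ Mfp.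
  apply/LpeqP => //.
  have := @Lpnorm_Mab_ge a b _ b0 (LpB gp fp).
  rewrite (_ : Mab a b (_ \- _) =
      Mab a b (Minv (Mab a b f)) \- Mab a b f); last first.
    by apply/funext => z; rewrite /Mab/=; ring.
  have /(LpeqP (Lp_Mab a b0 gp) Mfp) -> := MMinv _ Mfp.
  have [r r0 ->] := Lpnorm_fin (LpB gp fp).
  rewrite -EFinM lee_fin pmulr_rle0; last first.
    rewrite normr_gt0 subr_eq0; apply: contra aB => /eqP/esym/divr1_eq ->.
    by [].
  by move=> rle0; congr EFin; apply/eqP; rewrite eq_le rle0.
- apply: (@squeeze_cvge _ _ _ _ (cst 0%E) _
      (fun N => (geometric (1 - q)^-1 q N)%:E)); last 2 first.
  + exact: cvg_cst.
  + have cq := @cvg_geometric _ (1 - q)^-1 _ nq1.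
    by apply: cvg_comp cq _.
  apply: nearW => N; apply/andP; split.
    have [f [fp f1]] := exists_Lpnorm1 p1.
    apply: (@le_trans _ _ (Lpnorm p (Minv f \- S N f)%R)); first exact: Lnorm_ge0.
    by apply: ereal_sup_ubound; exists f.
  apply: ub_ereal_sup => _ [f [fp f1] <-]; have [_ fS] := MinvP f fp.
  by rewrite (le_trans (fS N))// f1 mule1 lee_fin/= mulrC.
Qed.
End Lp.

(** * The two Neumann series *)

Section neumann.
Context (R : realType) (p : \bar R) (a b : R).
Hypotheses (p1 : (1 <= p)%E) (b0 : b != 0).
Implicit Types (g : R -> R).

Lemma TbK g : Tb b (Tb b^-1 g) = g.
Proof. by apply/funext => x; rewrite /Tb mulrA mulVf// mul1r. Qed.

Lemma TbVK g : Tb b^-1 (Tb b g) = g.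
Proof. by apply/funext => x; rewrite /Tb mulrA divff// mul1r. Qed.

(** Telescoping: [a * Tb b] sends each term of the sum to the next, so only the first and the
    shifted last term survive. *)
Lemma Mab_neumann_lt N g : Mab a b (neumann_lt a b N g) \- g =
  fun x => - a ^+ N * iter N (Tb b) g x.
Proof.
apply/funext => x; rewrite /Mab/=; elim: N => [|N IH].
  by rewrite /neumann_lt !big_ord0/=; ring.
have step y : neumann_lt a b N.+1 g y =
    neumann_lt a b N g y + a ^+ N * iter N (Tb b) g y.
  by rewrite /neumann_lt big_ord_recr.
have iterb : iter N.+1 (Tb b) g x = iter N (Tb b) g (b * x) by [].
rewrite !step iterb exprS.
rewrite (_ : _ - g x = (neumann_lt a b N g x - a * neumann_lt a b N g (b * x)
  - g x) + a ^+ N * iter N (Tb b) g x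
  - a * a ^+ N * iter N (Tb b) g (b * x)); last by ring.
by rewrite IH; ring.
Qed.

(** The same telescoping backwards: [a * Tb b] lowers the index of each term by one, so the term of
    index 1 yields [g] and only the last one remains. *)
Lemma Mab_neumann_gt N g : a != 0 -> Mab a b (neumann_gt a b N g) \- g =
  fun x => - a^-1 ^+ N * iter N (Tb b^-1) g x.
Proof.
move=> a0; apply/funext => x; rewrite /Mab/=; elim: N => [|N IH].
  by rewrite /neumann_gt !big_nil/=; ring.
have step y : neumann_gt a b N.+1 g y =
    neumann_gt a b N g y - a^-1 ^+ N.+1 * iter N.+1 (Tb b^-1) g y.
  by rewrite /neumann_gt big_nat_recr//= opprD.
have iterb : iter N.+1 (Tb b^-1) g (b * x) = iter N (Tb b^-1) g x.
  by rewrite /= -[RHS](congr1 (@^~ x) (TbK _)).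
rewrite !step iterb.
rewrite (_ : _ - g x = (neumann_gt a b N g x - a * neumann_gt a b N g (b * x)
  - g x) + a * a^-1 ^+ N.+1 * iter N (Tb b^-1) g x
  - a^-1 ^+ N.+1 * iter N.+1 (Tb b^-1) g x); last by ring.
by rewrite IH exprS mulrA divff// mul1r mulNr addNr add0r mulNr.
Qed.

Lemma neumann_lt_inverse :
  `|a| < bpow p b -> is_inverse_series p a b (neumann_lt a b).
Proof.
move=> aB; have B0 := bpow_gt0 p b0.
have hN n g : g \in Lp p ->
    Lpnorm p (fun x => a ^+ n * iter n (Tb b) g x) =
    (((`|a| / bpow p b) ^+ n)%:E * Lpnorm p g)%E.
  move=> gp; have [Tp TN] := Lpnorm_iter_Tb p1 n b0 gp.
  by rewrite /Lpnorm Lnorm_scale// -!/(Lpnorm _ _) TN muleA -EFinM normrX exprMn.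
apply: (@neumann_is_inverse _ _ p1 a b _
  (fun n g x => a ^+ n * iter n (Tb b) g x) (`|a| / bpow p b)) => //.
- by rewrite lt_eqF.
- by rewrite divr_ge0 ?(ltW B0)//= ltr_pdivrMr// mul1r.
- by move=> n g gp; apply: LpZ => //; exact: (Lpnorm_iter_Tb p1 n b0 gp).1.
- by move=> n g gp; rewrite hN.
- move=> N g gp; rewrite Mab_neumann_lt -(hN N g gp).
  have [Tp _] := Lpnorm_iter_Tb p1 N b0 gp.
  by rewrite /Lpnorm !Lnorm_scale// normrN.
Qed.

Lemma neumann_gt_inverse :
  bpow p b < `|a| -> is_inverse_series p a b (neumann_gt a b).
Proof.
move=> aB; have B0 := bpow_gt0 p b0.
have bV0 : b^-1 != 0 by rewrite invr_eq0.
have na0 : 0 < `|a| by exact: lt_trans aB.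
have a0 : a != 0 by rewrite -normr_gt0.
have q0 : 0 <= bpow p b / `|a| by rewrite divr_ge0// ltW.
have q1 : bpow p b / `|a| < 1 by rewrite ltr_pdivrMr// mul1r.
(* The coefficient [c] is fixed only up to sign, which covers both the terms and the residual. *)
have hN c n g : g \in Lp p -> `|c| = `|a|^-1 ^+ n ->
    Lpnorm p (fun x => c * iter n (Tb b^-1) g x) =
    (((bpow p b / `|a|) ^+ n)%:E * Lpnorm p g)%E.
  move=> gp cE; have [Tp TN] := Lpnorm_iter_Tb p1 n bV0 gp.
  rewrite /Lpnorm Lnorm_scale// -!/(Lpnorm _ _) TN muleA -EFinM cE.
  by rewrite bpowV invrK mulrC exprMn.
apply: (@neumann_is_inverse _ _ p1 a b _
  (fun n g x => - a^-1 ^+ n.+1 * iter n.+1 (Tb b^-1) g x)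
  (bpow p b / `|a|)) => //.
- by rewrite gt_eqF.
- by rewrite q0 q1.
- move=> N g; apply/funext => x; rewrite /neumann_gt -sumrN big_add1/= big_mkord.
  by apply: eq_bigr => i _; rewrite mulNr.
- by move=> n g gp; apply: LpZ => //; exact: (Lpnorm_iter_Tb p1 n.+1 bV0 gp).1.
(* The sum starts at index 1, so term [n] carries [q ^+ n.+1], which is at most [q ^+ n] because
   [q < 1]. *)
- move=> n g gp; rewrite (hN _ n.+1)//; last by rewrite normrN normrX normfV.
  rewrite lee_wpmul2r ?Lnorm_ge0// lee_fin exprS ler_piMl ?exprn_ge0//.
  exact: ltW.
- by move=> N g gp; rewrite Mab_neumann_gt// (hN _ N)// normrN normrX normfV.
Qed.

End neumann.

Theorem theorem3p2 (R : realType) (p : \bar R) (a b : R) :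
  (1 <= p)%E -> b != 0 -> `|a| != bpow p b ->
  [/\ Lp_homeomorphism p (Tb b) /\ Lp_homeomorphism p (Mab a b),
      (* (1) T_b^{-1} = T_{1/b} *)
      (forall f, f \in Lp p ->
         [/\ Tb b^-1 f \in Lp p, Lpeq (Tb b (Tb b^-1 f)) f
           & Lpeq (Tb b^-1 (Tb b f)) f]),
      (* (2) ||T_b||_p = |b|^{-1/p} *)
      opnorm p (Tb b) = ((bpow p b)^-1)%:E,
      (* (3) two-sided norm estimate for M_{a,b} *)
      (forall f, f \in Lp p ->
         ((`|1 - `|a| / bpow p b|)%:E * Lpnorm p f <= Lpnorm p (Mab a b f))%E /\
         (Lpnorm p (Mab a b f) <= (1 + `|a| / bpow p b)%:E * Lpnorm p f)%E) &
      (* (4) Neumann series for M_{a,b}^{-1} *)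
      ((`|a| < bpow p b -> is_inverse_series p a b (neumann_lt a b)) /\
       (bpow p b < `|a| -> is_inverse_series p a b (neumann_gt a b)))].
Proof.
move=> p1 b0 aB; have B0 := bpow_gt0 p b0.
have bV0 : b^-1 != 0 by rewrite invr_eq0.
have TbN f : f \in Lp p ->
    Lpnorm p (Tb b f) = (((bpow p b)^-1)%:E * Lpnorm p f)%E.
  by move=> fp; rewrite Lpnorm_Tb//; exact: Lp_measurable fp.
(* Whichever series applies, its limit supplies the preimages for surjectivity of [Mab a b]. *)
have Minv : exists S, is_inverse_series p a b S.
  by move: aB; rewrite neq_lt => /orP[/neumann_lt_inverse|/neumann_gt_inverse] H;
    eexists; exact: H.
split.
- split.
  + apply: (@bounded_below_homeomorphism _ _ p1 _ (bpow p b)^-1 (bpow p b)^-1);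
      rewrite ?invr_gt0//.
    * by move=> f; exact: Lp_Tb.
    * by move=> f /TbN ->.
    * by move=> f /TbN ->.
    * move=> g gp; exists (Tb b^-1 g); split; first exact: Lp_Tb.
      by rewrite TbK//; exact: ae_eq_refl.
  + have [S [M [Mp MM _ _ _]]] := Minv.
    apply: (@bounded_below_homeomorphism _ _ p1 _ `|1 - `|a| / bpow p b|
      (1 + `|a| / bpow p b)) => //.
    * rewrite normr_gt0 subr_eq0; apply: contra aB => /eqP/esym/divr1_eq ->.
      by [].
    * by rewrite ltr_pwDl// divr_ge0// ltW.
    * by move=> f; exact: Lp_Mab.
    * by move=> f g; apply/funext => x; rewrite /Mab/=; ring.
    * by move=> f; exact: Lpnorm_Mab_ge.
    * by move=> f; exact: Lpnorm_Mab_le.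
    * by move=> g gp; exists (M g); split; [exact: Mp|exact: MM].
- move=> f fp; rewrite TbK// TbVK//; split; first exact: Lp_Tb.
  + exact: ae_eq_refl.
  + exact: ae_eq_refl.
(* [Tb b] scales every norm exactly, so the norms of the images of unit vectors form a singleton. *)
- rewrite /opnorm (_ : [set _ | _ in _] = [set ((bpow p b)^-1)%:E]).
    exact: ereal_sup1.
  apply/seteqP; split => [_ [f [fp f1] <-]|_ ->] /=.
    by rewrite TbN// f1 mule1.
  have [f [fp f1]] := exists_Lpnorm1 p1.
  by exists f => //; rewrite TbN// f1 mule1.
- by move=> f fp; split; [exact: Lpnorm_Mab_ge|exact: Lpnorm_Mab_le].
- by split; [exact: neumann_lt_inverse|exact: neumann_gt_inverse].
Qed.
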